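(* Let $\alpha>0$, $\beta>0$. The recurrence coefficients $\alpha_n=\alpha_n(t)$ and $\beta_n=\beta_n(t)$ of the monic orthogonal polynomials for the weight $w(x;t)=e^{-t/x}x^\alpha(1-x)^\beta$ on $[0,1]$ satisfy, for $t>0$, the differential equations $$t\frac{d}{dt}\alpha_n=r^*_n-r^*_{n+1}\qquad(n\ge0),$$ $$t\frac{d}{dt}\beta_n=(R^*_{n-1}-R^*_n)\,\beta_n\qquad(n\ge1),$$ where $R_n^*$ and $r_n^*$ are defined in the context.
   Context: $P_n$ is the monic polynomial of degree $n$ with $\int_0^1P_mP_nw\,dx=h_n\delta_{m,n}$. The recurrence coefficients $\alpha_n,\beta_n$ (not to be confused with the parameters $\alpha,\beta$) are defined by $xP_n(x)=P_{n+1}(x)+\alpha_nP_n(x)+\beta_nP_{n-1}(x)$, with $P_0=1$, $\beta_0P_{-1}=0$. Auxiliary quantities: $R_n^*:=\frac{t}{h_n}\int_0^1[P_n(y)]^2w(y;t)\frac{dy}{y}$, $r_n^*:=\frac{t}{h_{n-1}}\int_0^1P_{n-1}(y)P_n(y)w(y;t)\frac{dy}{y}$, with $r_0^*:=0$. *)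

(* Defs.v *)
From HB Require Import structures.
From mathcomp Require Import all_boot all_order all_algebra.
From mathcomp Require Import all_classical all_reals all_analysis.

Set Implicit Arguments.
Unset Strict Implicit.
Unset Printing Implicit Defensive.

Import Order.TTheory GRing.Theory Num.Theory.
Import numFieldNormedType.Exports.
Local Open Scope ring_scope.

(* At x = 0 the total operations give [- t / 0 = 0], hence [weight alpha beta t 0
   = 0] for [alpha != 0]; the endpoints are in any case negligible for the
   Lebesgue integrals below. *)
Definition weight (R : realType) (alpha beta t x : R) : R :=
  expR (- t / x) * x `^ alpha * (1 - x) `^ beta.

Definition monic_orthogonal (R : realType) (w : R -> R)
    (P : nat -> {poly R}) (h : nat -> R) : Prop :=
  (forall n : nat, P n \is monic /\ size (P n) = n.+1) /\
  (forall m n : nat,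
     \int[@lebesgue_measure R]_(x in `[0, 1]) ((P m).[x] * (P n).[x] * w x)
     = h n * (m == n)%:R).

(* The case [n = 0] encodes the convention [beta_0 P_{-1} = 0]; in particular
   [b 0] is not constrained. *)
Definition recurrence_coefs (R : realType) (P : nat -> {poly R})
    (a b : nat -> R) : Prop :=
  P 0%N = 1 /\
  forall n : nat,
    'X * P n = P n.+1 + a n *: P n + (if n is k.+1 then b n *: P k else 0).

Definition Rstar (R : realType) (w : R -> R) (P : nat -> {poly R})
    (h : nat -> R) (t : R) (n : nat) : R :=
  t / h n * \int[@lebesgue_measure R]_(y in `[0, 1]) ((P n).[y] ^+ 2 * w y / y).

Definition rstar (R : realType) (w : R -> R) (P : nat -> {poly R})
    (h : nat -> R) (t : R) (n : nat) : R :=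
  if n is k.+1 then
    t / h k *
    \int[@lebesgue_measure R]_(y in `[0, 1]) ((P k).[y] * (P n).[y] * w y / y)
  else 0.

(* Main.v *)
(* Writing L_t p for the integral of p w(.;t) and K_t p for that of p w(.;t)/x,
   one has d/dt (L_t p) = - K_t p, since the t-derivative of exp(-t/x) is
   - exp(-t/x)/x, and it is bounded by 1/t. The three-term recurrence shows by
   induction on n that the coefficients of P_n, and h_n, alpha_n, beta_n, are
   differentiable in t. As dP_n/dt has degree < n, differentiating
   h_n = L_t(P_n^2) gives h_n' = - K_t(P_n^2), and beta_n = h_n / h_(n-1).
   Let p_n be the coefficient of x^(n-1) in P_n, so alpha_n = p_n - p_(n+1);
   differentiating 0 = L_t(P_(n+1) P_n) gives p_(n+1)' h_n = K_t(P_(n+1) P_n). *)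
Require Import Defs.
From HB Require Import structures.
From mathcomp Require Import all_boot all_order all_algebra.
From mathcomp Require Import all_classical all_reals all_analysis.
From mathcomp Require Import finmap ring measurable_realfun.
Import Order.TTheory GRing.Theory Num.Theory.
Import numFieldNormedType.Exports.
Local Open Scope ring_scope.

(** * Boundedness, measurability and integrability on [0,1] *)

Lemma bounded_funP {R : realType} (T : Type) (A : set T) (f : T -> R) (M : R) :
  (forall x, A x -> `|f x| <= M) -> [bounded f x | x in A].
Proof.
move=> fM; exists M; split; first exact: num_real.
by move=> N /ltW MN x Ax; exact: le_trans (fM x Ax) MN.
Qed.

(** Inversion is discontinuous at 0; on nonnegative reals it agrees with the power function of
    exponent -1, both giving 0 at 0. *)
Lemma measurable_fun_inv_nneg {R : realType} (D : set R) :
  measurable D -> (forall x, D x -> 0 <= x) -> measurable_fun D (fun x => x^-1).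
Proof.
move=> mD D0.
apply: (eq_measurable_fun (fun x : R => x `^ (-1))).
  by move=> x /set_mem/D0 x0; rewrite powR_inv1.
by apply: measurable_funS (measurable_powR (-1)).
Qed.

Definition horner_bound {R : realType} (p : {poly R}) : R :=
  \sum_(i < size p) `|p`_i|.

Lemma horner_bound_ge0 {R : realType} (p : {poly R}) : 0 <= horner_bound p.
Proof. by apply: sumr_ge0. Qed.

Lemma ler_horner_bound {R : realType} (p : {poly R}) (x : R) :
  0 <= x <= 1 -> `|p.[x]| <= horner_bound p.
Proof.
move=> /andP[x0 x1]; rewrite horner_coef (le_trans (ler_norm_sum _ _ _))//.
apply: ler_sum => i _; rewrite normrM ler_piMr// ger0_norm ?exprn_ge0//.
exact: exprn_ile1.
Qed.

Local Notation I01 R := (`[0 : Real.sort R, 1]%classic).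

Lemma bounded_integrable01 {R : realType} (f : R -> R) (M : R) :
  measurable_fun (I01 R) f -> (forall x, (I01 R) x -> `|f x| <= M) ->
  (@lebesgue_measure R).-integrable (I01 R) (EFin \o f).
Proof.
move=> mf fM; apply: measurable_bounded_integrable => //.
- by rewrite /= lebesgue_measure_itv/= lte_fin ltr01 oppr0 addr0 ltry.
- exact: bounded_funP fM.
Qed.

(** * Bounds and integrability for w and w/x *)

Section weight.
Context {R : realType} (alpha beta : R).
Hypotheses (alpha0 : 0 < alpha) (beta0 : 0 < beta).
Implicit Types (t x : R) (p : {poly R}).

Lemma powR_le1 (r x : R) : 0 < r -> 0 <= x <= 1 -> x `^ r <= 1.
Proof.
move=> r0 /andP[x0 x1]; have := @ge0_ler_powR R r (ltW r0) x 1.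
by rewrite !nnegrE powR1; apply.
Qed.

Lemma weight_ge0 t x : 0 <= weight alpha beta t x.
Proof. by rewrite !mulr_ge0 ?expR_ge0 ?powR_ge0. Qed.

Lemma weight_gt0 t x : 0 < x < 1 -> 0 < weight alpha beta t x.
Proof.
by move=> /andP[x0 x1]; rewrite !mulr_gt0 ?expR_gt0 ?powR_gt0// subr_gt0.
Qed.

Lemma weight_le1 t x : 0 < t -> 0 <= x <= 1 -> weight alpha beta t x <= 1.
Proof.
move=> t0 /andP[x0 x1].
rewrite /weight !mulr_ile1 ?mulr_ge0 ?expR_ge0 ?powR_ge0//.
- by rewrite expR_le1 mulr_le0_ge0 ?oppr_le0 ?invr_ge0// ltW.
- by rewrite powR_le1 ?x0.
- by rewrite powR_le1// subr_ge0 x1 lerBlDr lerDl.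
Qed.

(* With u = t / x this is u e^{-u} <= 1. *)
Lemma weight_div_le t x : 0 < t -> 0 <= x <= 1 ->
  weight alpha beta t x / x <= t^-1.
Proof.
move=> t0 /andP[]; rewrite le_eqVlt => /predU1P[<- _|x0 x1].
  (* At x = 0 the total inverse is 0, so the left side vanishes. *)
  by rewrite invr0 mulr0 invr_ge0 ltW.
rewrite ler_pdivrMr//; apply: (@le_trans _ _ (expR (- t / x))).
  rewrite /weight -mulrA ler_piMr ?expR_ge0// mulr_ile1 ?powR_ge0//.
    by rewrite powR_le1 ?x1 ?ltW.
  by rewrite powR_le1// subr_ge0 x1 lerBlDr lerDl ltW.
(* Inverting both sides leaves t/x <= exp(t/x), a consequence of 1 + u <= exp u. *)
rewrite mulNr expRN -[leRHS]invrK.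
rewrite lef_pV2 ?posrE ?expR_gt0 ?invr_gt0 ?mulr_gt0 ?invr_gt0//.
rewrite invfM invrK; apply: le_trans (expR_ge1Dx _).
by rewrite lerDr.
Qed.

Lemma measurable_weight t : measurable_fun (I01 R) (weight alpha beta t).
Proof.
have pow r : measurable_fun (I01 R) (fun x => x `^ r).
  by apply: measurable_funS (measurable_powR r).
apply: measurable_funM; first apply: measurable_funM => //.
- apply: (@measurableT_comp _ _ _ _ _ _ _ _ (fun x => - t / x)
    (@measurable_expR R)).
  apply: measurable_funM => //; apply: measurable_fun_inv_nneg => //.
  by move=> x; rewrite /= in_itv/= => /andP[].
- apply: measurable_funS (_ : measurable_fun setT _) => //.
  apply: (measurableT_comp (measurable_powR beta)).
  exact: measurable_funB.
Qed.

Lemma measurable_weight_div t :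
  measurable_fun (I01 R) (fun x => weight alpha beta t x / x).
Proof.
apply: measurable_funM (measurable_weight t) _.
apply: measurable_fun_inv_nneg=> //.
by move=> x; rewrite /= in_itv/= => /andP[].
Qed.

Lemma integrable_weight t : 0 < t ->
  (@lebesgue_measure R).-integrable (I01 R) (EFin \o weight alpha beta t).
Proof.
move=> t0; apply: (@bounded_integrable01 R _ 1) (measurable_weight t) _ => x.
rewrite /= in_itv/= => x01.
by rewrite ger0_norm ?weight_ge0// weight_le1.
Qed.

Lemma integrable_weight_div t : 0 < t ->
  (@lebesgue_measure R).-integrable (I01 R)
    (EFin \o (fun x => weight alpha beta t x / x)).
Proof.
move=> t0.
apply: (@bounded_integrable01 R _ t^-1) (measurable_weight_div t) _ => x.
rewrite /= in_itv/= => /[dup] x01 /andP[x0 _].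
by rewrite /= ger0_norm ?weight_div_le// divr_ge0// weight_ge0.
Qed.

End weight.

(** * Moments against a weight: [moment] at w is L_t, at w/x it is K_t *)

Definition moment {R : realType} (w : R -> R) (p : {poly R}) : R :=
  \int[@lebesgue_measure R]_(x in `[0, 1]) (p.[x] * w x).

Section moment.
Context {R : realType} (w : R -> R).
Hypothesis iw : (@lebesgue_measure R).-integrable (I01 R) (EFin \o w).
Implicit Types (p q : {poly R}).

Lemma integrable_horner_weight p :
  (@lebesgue_measure R).-integrable (I01 R) (EFin \o (fun x => p.[x] * w x)).
Proof.
have -> : EFin \o (fun x => p.[x] * w x) =
    ((EFin \o horner p) \* (EFin \o w))%E.
  by [].
apply: integrableMr iw => //.
  exact: measurable_poly.
apply: (@bounded_funP R _ _ _ (horner_bound p)) => x.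
by rewrite /= in_itv/=; exact: ler_horner_bound.
Qed.

Lemma momentD p q : moment w (p + q) = moment w p + moment w q.
Proof.
rewrite -RintegralD//; [|exact: integrable_horner_weight..].
by apply: eq_Rintegral => x _; rewrite hornerD mulrDl.
Qed.

Lemma momentZ c p : moment w (c *: p) = c * moment w p.
Proof.
rewrite -RintegralZl//; last exact: integrable_horner_weight.
by apply: eq_Rintegral => x _; rewrite hornerZ mulrA.
Qed.

Lemma moment0 : moment w 0 = 0.
Proof. by rewrite -(scale0r 0) momentZ mul0r. Qed.

Lemma moment_sum n (F : 'I_n -> {poly R}) :
  moment w (\sum_(i < n) F i) = \sum_(i < n) moment w (F i).
Proof.
elim/big_ind2 : _ => //; first exact: moment0.
by move=> _ p _ q <- <-; exact: momentD.
Qed.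

(** Reduction to power moments by linearity. The bound [n] may exceed the size, so that one [n]
    serves a whole family of polynomials. *)
Lemma moment_coef n p : (size p <= n)%N ->
  moment w p = \sum_(i < n) p`_i * moment w 'X^i.
Proof.
move=> pn; have {1}-> : p = \sum_(i < n) p`_i *: 'X^i.
  rewrite -(poly_def n (fun i => p`_i)); apply/polyP => i; rewrite coef_poly.
  by case: ltnP => // ni; rewrite nth_default// (leq_trans pn).
by rewrite moment_sum; apply: eq_bigr => i _; rewrite momentZ.
Qed.

End moment.

(** * Nonvanishing of the square norms *)

Lemma exists_nonroot_itv01 {R : realType} (p : {poly R}) (N : set R) :
  p != 0 -> (@lebesgue_measure R).-negligible N ->
  exists2 x, 0 < x < 1 & ~ N x /\ ~~ root p x.
Proof.
move=> p0 negN; apply: contrapT => nex.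
have negroots : (@lebesgue_measure R).-negligible [set x | root p x].
  have fin : finite_set [set x | root p x]%classic.
    (* A finite set of at least [size p] roots is more than a nonzero polynomial can have. *)
    apply: contrapT => /(infinite_set_fset (size p))[B BR sB].
    have : (size (enum_fset B) < size p)%N.
      apply: max_poly_roots => //; last exact: fset_uniq.
      by apply/allP => x xB; apply: BR.
    by rewrite ltnNge sB.
  exists [set x | root p x]%classic; split => //.
    exact/countable_measurable/finite_set_countable.
  exact/countable_lebesgue_measure0/finite_set_countable.
(* By [nex] every point of ]0,1[ lies in [N] or is a root, so this interval of measure 1 would be
   null. *)
have : (@lebesgue_measure R).-negligible `]0, 1[%classic.
  apply: negligibleS (negligibleU negN negroots) => x.
  rewrite /= in_itv/= => x01; apply: contrapT => /not_orP[Nx /negP rx].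
  by apply: nex; exists x.
move/negligibleP => /(_ (measurable_itv _)).
rewrite /= lebesgue_measure_itv/= lte_fin ltr01 oppr0 addr0 => /eqP.
by rewrite eqe oner_eq0.
Qed.

(** A vanishing integral of the nonnegative p^2 w forces p^2 w = 0 almost everywhere on [0,1], yet
    it is positive at every nonroot in ]0,1[. *)
Lemma moment_sqr_neq0 {R : realType} (w : R -> R) (p : {poly R}) :
  (@lebesgue_measure R).-integrable (I01 R) (EFin \o w) ->
  (forall x, 0 <= w x) -> (forall x, 0 < x < 1 -> 0 < w x) ->
  p != 0 -> moment w (p * p) != 0.
Proof.
move=> iw w0 wgt0 p0; apply/eqP => pp0.
have ipp := integrable_horner_weight w iw (p * p).
have int0 : (\int[@lebesgue_measure R]_(x in I01 R)
    `|((p * p).[x] * w x)%R%:E| = 0)%E.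
  have nn x : `|((p * p).[x] * w x)%:E|%E = ((p * p).[x] * w x)%:E.
    by rewrite /= ger0_norm// mulr_ge0// hornerM -expr2 sqr_ge0.
  under eq_integral do rewrite nn.
  rewrite -[LHS]fineK; first by rewrite -[fine _]/(moment w (p * p)) pp0.
  exact: integrable_fin_num ipp.
have mpp : measurable_fun (I01 R) (EFin \o (fun x => (p * p).[x] * w x)).
  by case/integrableP: ipp.
have [/(_ int0) ae0 _] :=
  @ae_eq_integral_abs _ _ R lebesgue_measure _ (measurable_itv `[0, 1]) _ mpp.
have [x x01 [Nx rx]] := exists_nonroot_itv01 p _ p0 ae0.
apply: Nx => /=; rewrite in_itv/=; case/andP: (x01) => x0 x1.
rewrite !ltW// => /(_ isT)[/eqP].
by rewrite hornerM !mulf_eq0 -rootE (negbTE rx)/= gt_eqF// wgt0.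
Qed.

(** * Differentiation under the integral sign *)

Lemma is_derive_moment {R : realType} (alpha beta t : R) (p : {poly R}) :
  0 < alpha -> 0 < beta -> 0 < t ->
  is_derive t 1 (fun s => moment (weight alpha beta s) p)
    (- moment (fun x => weight alpha beta t x / x) p).
Proof.
move=> alpha0 beta0 t0.
pose f s x := p.[x] * weight alpha beta s x.
have df (s x : R) : is_derive s 1 (f^~ x)
    (- (p.[x] * (weight alpha beta s x / x))).
  have di : is_derive s 1 (fun s : R => - s / x) (- x^-1).
    have -> : (fun s => - s / x) = (- x^-1) \*: id.
      by apply/funext => r /=; rewrite mulNr mulrC -mulNr.
    by apply: is_derive_eq; rewrite -[_ *: _]/(_ * _) mulr1.
  have de : is_derive s 1 (fun s : R => expR (- s / x))
      (expR (- s / x) * (- x^-1)).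
    exact: (@is_derive1_comp _ expR (fun s => - s / x)).
  have -> : f^~ x =
      (p.[x] * (x `^ alpha * (1 - x) `^ beta)) \*: (fun s => expR (- s / x)).
    by apply/funext => r /=; rewrite /f /weight -[_ *: _]/(_ * _); ring.
  by apply: is_derive_eq; rewrite /weight -[_ *: _]/(_ * _); ring.
(* On this window s stays above t/2, which makes the bound 1/s on w/x uniform. *)
have tI : `]t / 2, t * 2[%classic t.
  by rewrite /= in_itv/= gtr_pMr// ltr_pMr// ltr1n invf_lt1// ltr1n.
have s0 (s : R) : `]t / 2, t * 2[%classic s -> t / 2 < s /\ 0 < s.
  rewrite /= in_itv/= => /andP[ts _]; split => //.
  by apply: lt_trans ts; rewrite divr_gt0.
have intf s : `]t / 2, t * 2[%classic s -> 
    (@lebesgue_measure R).-integrable (I01 R) (EFin \o f s).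
  by move=> /s0[_ s_gt0]; apply/integrable_horner_weight/integrable_weight.
(* Constant majorant: [horner_bound p] controls the polynomial and [(t / 2)^-1] controls w/x. *)
pose G (x : R) := horner_bound p * (t / 2)^-1.
have G0 x : 0 <= G x.
  by rewrite mulr_ge0 ?horner_bound_ge0// invr_ge0 divr_ge0// ltW.
have intG : (@lebesgue_measure R).-integrable (I01 R) (EFin \o G).
  apply: (@bounded_integrable01 R _ (G 0)); first exact: measurable_cst.
  by move=> x _; rewrite ger0_norm.
have d1f s x : partial1of2 f s x = - (p.[x] * (weight alpha beta s x / x)).
  by rewrite partial1of2E; apply: derive_val.
have fG s x : `]t / 2, t * 2[%classic s -> I01 R x ->
    `|partial1of2 f s x| <= G x.
  move=> /s0[ts s_gt0]; rewrite /= in_itv/= => x01.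
  rewrite d1f normrN normrM ler_pM//; first exact: ler_horner_bound.
  rewrite ger0_norm; last by rewrite divr_ge0 ?weight_ge0//; case/andP: x01.
  apply: le_trans (weight_div_le _ _ _ _ _ _ s_gt0 x01) _ => //.
  by rewrite lef_pV2 ?posrE ?divr_gt0// ltW.
have dF s x : `]t / 2, t * 2[%classic s -> I01 R x -> derivable (f^~ x) s 1.
  by move=> _ _; case: (df s x).
apply: DeriveDef.
  have := @derivable_under_integral R _ _ lebesgue_measure f _
    (measurable_itv _) _ _ _ tI intf dF G G0 intG fG.
  by [].
rewrite -derive1E.
have -> := @differentiation_under_integral R _ _ lebesgue_measure f _
  (measurable_itv _) _ _ _ tI intf dF G G0 intG fG.
rewrite -mulN1r -momentZ; last exact: integrable_weight_div.
by apply: eq_Rintegral => x _; rewrite d1f hornerZ mulN1r mulNr.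
Qed.

(* Coefficientwise derivative; the local degree bound makes [moment] a finite
   sum over the coefficients. *)
Definition is_derive_poly {R : realType} (p : R -> {poly R}) (t : R)
    (q : {poly R}) : Prop :=
  (exists n, \forall s \near t, (size (p s) <= n)%N) /\
  forall i, is_derive t 1 (fun s => (p s)`_i) q`_i.

(** * Differentiation rules for polynomials depending on a parameter *)

Section is_derive_poly.
Context {R : realType}.
Implicit Types (p q : R -> {poly R}) (u v : {poly R}) (t : R).

(** Identities for P_n at parameter s are available only for s > 0, so they are transferred in a
    neighbourhood of t. *)
Lemma is_derive_poly_near p q t u :
  (\near t, p t = q t) -> is_derive_poly p t u -> is_derive_poly q t u.
Proof.
move=> pq [[n pn] dp]; split.
  exists n; near=> s.
have <- : p s = q s by near: s.
  by near: s.
move=> i; apply: near_eq_is_derive (dp i); near=> s.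
by have <- : p s = q s by near: s.
Unshelve. all: by end_near. Qed.

Lemma is_derive_poly_cst (r : {poly R}) t : is_derive_poly (fun=> r) t 0.
Proof.
split; first by exists (size r); near=> s.
by move=> i; rewrite coef0; exact: is_derive_cst.
Unshelve. all: by end_near. Qed.

Lemma is_derive_polyC (c : R -> R) t c' :
  is_derive t 1 c c' -> is_derive_poly (fun s => (c s)%:P) t c'%:P.
Proof.
move=> dc; split; first by exists 1%N; near=> s; exact: size_polyC_leq1.
move=> [|i]; rewrite !coefC/=.
  by under eq_fun do rewrite coefC.
by under eq_fun do rewrite coefC/=; exact: is_derive_cst.
Unshelve. all: by end_near. Qed.

Lemma is_derive_polyB p q t u v :
  is_derive_poly p t u -> is_derive_poly q t v ->
  is_derive_poly (fun s => p s - q s) t (u - v).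
Proof.
move=> [[m pm] dp] [[n qn] dq]; split.
  exists (maxn m n); near=> s.
  rewrite (leq_trans (size_polyD _ _))// size_polyN geq_max !leq_max.
  by rewrite (near pm s)// (near qn s)// orbT.
move=> i; rewrite coefB; under eq_fun do rewrite coefB.
exact: is_deriveB (dp i) (dq i).
Unshelve. all: by end_near. Qed.

(** Leibniz rule, termwise in the convolution formula for the coefficients of a product. *)
Lemma is_derive_polyM p q t u v :
  is_derive_poly p t u -> is_derive_poly q t v ->
  is_derive_poly (fun s => p s * q s) t (u * q t + p t * v).
Proof.
move=> [[m pm] dp] [[n qn] dq]; split.
  exists (m + n)%N; near=> s.
  rewrite (leq_trans (size_polyMleq _ _))// (leq_trans (leq_pred _))//.
  by rewrite leq_add// ?(near pm s) ?(near qn s).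
move=> i; rewrite coefD !coefM -big_split/=.
have -> : (fun s => (p s * q s)`_i) =
    \sum_(j < i.+1) (fun s => (p s)`_j * (q s)`_(i - j)).
  by apply/funext => s; rewrite coefM fct_sumE.
apply: is_derive_sum => j.
have := is_deriveM (dp j) (dq (i - j)%N).
by move/is_derive_eq; apply; rewrite /GRing.scale/= [LHS]addrC (mulrC u`_j).
Unshelve. all: by end_near. Qed.

End is_derive_poly.

(** * Moments of a moving polynomial against the moving weight *)

Section derivative_of_moment.
Context {R : realType} (alpha beta : R).
Hypotheses (alpha0 : 0 < alpha) (beta0 : 0 < beta).

(** Near t, L_s(p(s)) is a finite sum of terms p_i(s) L_s(X^i); the product rule splits its
    derivative into L_t(u) and - K_t(p(t)). *)
Lemma is_derive_moment_poly (t : R) (p : R -> {poly R}) (u : {poly R}) :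
  0 < t -> is_derive_poly p t u ->
  is_derive t 1 (fun s => moment (weight alpha beta s) (p s))
    (moment (weight alpha beta t) u
     - moment (fun x => weight alpha beta t x / x) (p t)).
Proof.
move=> t0 [[n pn] dp].
(* Including [size u] lets the same number of terms expand the moment of [u]. *)
pose m := maxn n (size u).
have pm : \forall s \near t, (size (p s) <= m)%N.
  by near=> s; rewrite leq_max (near pn s).
have iw s : 0 < s -> _ := integrable_weight _ _ alpha0 beta0 s.
have ivw := integrable_weight_div _ _ alpha0 beta0 t t0.
apply: (near_eq_is_derive (f := \sum_(i < m) (fun s => (p s)`_i) *
    (fun s => moment (weight alpha beta s) 'X^i))).
  near=> s; rewrite fct_sumE (moment_coef _ (iw s _) m)//.
    by near: s; exact: lt_nbhsr.
  by near: s.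
have := is_derive_sum (fun i : 'I_m => is_deriveM (dp i)
  (is_derive_moment alpha beta t 'X^i alpha0 beta0 t0)).
move/is_derive_eq; apply.
rewrite (moment_coef _ (iw t t0) m) ?leq_maxr//.
rewrite (moment_coef _ ivw m); last exact: nbhs_singleton pm.
rewrite -sumrB; apply: eq_bigr => i _.
by rewrite /GRing.scale/= mulrN addrC (mulrC _ u`_i).
Unshelve. all: by end_near. Qed.

End derivative_of_moment.

(** * Orthogonality and the recurrence coefficients at a fixed weight *)

Section orthogonality.
Context {R : realType} (w : R -> R) (P : nat -> {poly R}) (h : nat -> R).
Hypothesis iw : (@lebesgue_measure R).-integrable (I01 R) (EFin \o w).
Hypothesis orthP : monic_orthogonal w P h.

Lemma size_ortho n : size (P n) = n.+1.
Proof. by case: orthP => /(_ n)[]. Qed.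

Lemma coef_ortho n : (P n)`_n = 1.
Proof. by case: orthP => /(_ n)[/monicP]; rewrite /lead_coef size_ortho. Qed.

Lemma moment_ortho m n : moment w (P m * P n) = h n * (m == n)%:R.
Proof.
case: orthP => _ <-; apply: eq_Rintegral => x _.
by rewrite hornerM.
Qed.

(** Induction on [k]: subtracting q_k P_k from q, with P_k monic of degree k, lowers the degree, and
    the removed term is orthogonal to P_n as k < n. *)
Lemma moment_ortho_lt k n (q : {poly R}) : (k <= n)%N -> (size q <= k)%N ->
  moment w (q * P n) = 0.
Proof.
elim: k q => [q _|k ih q kn qk].
  by rewrite leqn0 size_poly_eq0 => /eqP ->; rewrite mul0r moment0.
have -> : q = (q - q`_k *: P k) + q`_k *: P k by rewrite subrK.
rewrite mulrDl momentD// -scalerAl momentZ// moment_ortho (ltn_eqF kn).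
rewrite !mulr0 addr0.
apply: ih; first exact: ltnW.
apply/leq_sizeP => i; rewrite coefB coefZ leq_eqVlt => /predU1P[<-|ki].
  by rewrite coef_ortho mulr1 subrr.
by rewrite (nth_default _ (leq_trans qk ki))
  [(P k)`_i]nth_default ?size_ortho// mulr0 subrr.
Qed.

(** Splitting off q_n P_n leaves a polynomial of degree below n, which is orthogonal to P_n. *)
Lemma moment_ortho_coef n (q : {poly R}) : (size q <= n.+1)%N ->
  moment w (q * P n) = q`_n * h n.
Proof.
move=> qn; have -> : q * P n = (q - q`_n *: P n) * P n + q`_n *: (P n * P n).
  by rewrite mulrBl -scalerAl subrK.
rewrite momentD// momentZ// moment_ortho eqxx mulr1.
rewrite (@moment_ortho_lt n) ?add0r//.
apply/leq_sizeP => i; rewrite coefB coefZ leq_eqVlt => /predU1P[<-|ki].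
  by rewrite coef_ortho mulr1 subrr.
by rewrite (nth_default _ (leq_trans qn ki))
  [(P n)`_i]nth_default ?size_ortho// mulr0 subrr.
Qed.

Lemma ortho_norm n : moment w (P n * P n) = h n.
Proof. by rewrite moment_ortho eqxx mulr1. Qed.

Lemma ortho_norm_neq0 n :
  (forall x, 0 <= w x) -> (forall x, 0 < x < 1 -> 0 < w x) -> h n != 0.
Proof.
move=> w0 w1; rewrite -ortho_norm; apply: moment_sqr_neq0 => //.
by rewrite -size_poly_eq0 size_ortho.
Qed.

Context (a b : nat -> R).
Hypothesis recP : recurrence_coefs P a b.

(** Pairing the recurrence with P_n leaves only the diagonal term. *)
Lemma recurrence_coef_alpha n :
  a n * h n = moment w ('X * (P n * P n)).
Proof.
case: recP => _ rec; rewrite mulrA rec !mulrDl !momentD// -scalerAl momentZ//.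
rewrite ortho_norm moment_ortho eqn_leq ltnn mulr0 add0r.
case: n => [|n]; first by rewrite mul0r moment0// addr0.
by rewrite -scalerAl momentZ// moment_ortho ltn_eqF// !mulr0 addr0.
Qed.

(** Two evaluations of the moment of X P_(n+1) P_n: as X P_n is monic of degree n+1 it equals
    h_(n+1), and the recurrence for X P_(n+1) gives b_(n+1) h_n. *)
Lemma recurrence_coef_beta n : b n.+1 * h n = h n.+1.
Proof.
case: recP => _ rec.
have : moment w ('X * P n.+1 * P n) = h n.+1.
  rewrite mulrAC moment_ortho_coef; last first.
    by rewrite (leq_trans (size_polyMleq _ _))// size_polyX size_ortho.
  by rewrite coefXM/= coef_ortho mul1r.
rewrite rec !mulrDl !momentD// -!scalerAl !momentZ// ortho_norm !moment_ortho.
by rewrite !gtn_eqF// ?ltnW// !mulr0 !add0r.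
Qed.

(** Comparison of the coefficients of x^n in the recurrence; for n = 0 the product X P_0 contributes
    0. *)
Lemma recurrence_coef_subleading n :
  a n = (if n is k.+1 then (P n)`_k else 0) - (P n.+1)`_n.
Proof.
case: recP => _ /(_ n) /(congr1 (fun p : {poly R} => p`_n)).
rewrite !coefD coefXM coefZ coef_ortho mulr1.
case: n => [|n] /=.
  rewrite coef0 addr0 => /eqP.
  by rewrite eq_sym addrC addr_eq0 sub0r => /eqP.
rewrite coefZ [(P n)`_n.+1]nth_default ?size_ortho// mulr0 addr0 => ->.
by rewrite addrC addKr.
Qed.

End orthogonality.

(** Uniqueness of the derivative; it serves to bound the degree of dP_n/dt. *)
Lemma is_derive_poly_coef_cst {R : realType} (p : R -> {poly R}) (t : R)
    (u : {poly R}) (i : nat) (c : R) :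
  is_derive_poly p t u -> (\forall s \near t, (p s)`_i = c) -> u`_i = 0.
Proof.
move=> [_ /(_ i) dp] pc.
have d0 : is_derive t 1 (fun s => (p s)`_i) 0.
  apply: near_eq_is_derive (is_derive_cst c t 1).
  by near=> s; apply/esym; near: s.
by rewrite -(@derive_val _ _ _ _ _ _ _ dp) (@derive_val _ _ _ _ _ _ _ d0).
Unshelve. all: by end_near. Qed.

(** * Evolution in t of the orthogonal polynomials, norms and recurrence coefficients *)

Section evolution.
Context {R : realType} (alpha beta : R).
Hypotheses (alpha0 : 0 < alpha) (beta0 : 0 < beta).
Variables (P : nat -> R -> {poly R}) (h a b : nat -> R -> R).
Hypothesis orthP : forall t : R, 0 < t ->
  monic_orthogonal (weight alpha beta t) (P^~ t) (h^~ t).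
Hypothesis recP : forall t : R, 0 < t ->
  recurrence_coefs (P^~ t) (a^~ t) (b^~ t).

Let iw t (t0 : 0 < t) := integrable_weight _ _ alpha0 beta0 t t0.
Let iwd t (t0 : 0 < t) := integrable_weight_div _ _ alpha0 beta0 t t0.

Lemma weight_norm_neq0 n t : 0 < t -> h n t != 0.
Proof.
move=> t0; apply: (ortho_norm_neq0 _ _ _ (iw t t0) (orthP t t0)).
  by move=> x; exact: weight_ge0.
by move=> x; exact: weight_gt0.
Qed.

(** For s > 0 the coefficient of x^n in P_n is constantly 1 and the higher ones are constantly 0. *)
Lemma size_is_derive_ortho n t u : 0 < t -> is_derive_poly (P n) t u ->
  (size u <= n)%N.
Proof.
move=> t0 du; apply/leq_sizeP => i; rewrite leq_eqVlt => /predU1P[<-|ni].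
  apply: (is_derive_poly_coef_cst _ _ _ n 1 du); near=> s.
  apply: (coef_ortho _ _ _ (orthP s _)); near: s; exact: lt_nbhsr.
apply: (is_derive_poly_coef_cst _ _ _ i 0 du); near=> s.
rewrite nth_default// (size_ortho _ _ _ (orthP s _))//.
near: s; exact: lt_nbhsr.
Unshelve. all: by end_near. Qed.

(** The derivative of L_t(P_n^2) is 2 L_t(u P_n) - K_t(P_n^2), and the first term vanishes because u
    has degree below n. *)
Lemma is_derive_ortho_norm n t u : 0 < t -> is_derive_poly (P n) t u ->
  is_derive t 1 (h n)
    (- moment (fun x => weight alpha beta t x / x) (P n t * P n t)).
Proof.
move=> t0 du.
apply: (near_eq_is_derive
    (f := fun s => moment (weight alpha beta s) (P n s * P n s))).
  near=> s; have s0 : 0 < s by near: s; exact: lt_nbhsr.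
  exact: (ortho_norm _ _ _ (orthP s s0)).
have := is_derive_moment_poly _ _ alpha0 beta0 _ _ _ t0
  (is_derive_polyM _ _ _ _ _ du du).
move/is_derive_eq; apply.
have L0 := moment_ortho_lt _ _ _ (iw t t0) (orthP t t0) n n u (leqnn _)
  (size_is_derive_ortho _ _ _ t0 du).
by rewrite (mulrC (P n t) u) (momentD _ (iw t t0)) L0 addr0 sub0r.
Unshelve. all: by end_near. Qed.

(** a_n = L_t(X P_n^2) / h_n is a quotient of differentiable functions once P_n is differentiable,
    which is what the induction on n can supply. *)
Lemma derivable_recurrence_alpha n t u : 0 < t -> is_derive_poly (P n) t u ->
  derivable (a n) t 1.
Proof.
move=> t0 du.
apply: (near_eq_derivable (f :=
  (fun s => moment (weight alpha beta s) ('X * (P n s * P n s))) *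
  (fun s => (h n s)^-1))).
  near=> s; have s0 : 0 < s by near: s; exact: lt_nbhsr.
  rewrite -[LHS]/(moment (weight alpha beta s) ('X * (P n s * P n s)) / h n s).
  have <- := recurrence_coef_alpha _ _ _ (iw s s0) (orthP s s0) _ _
    (recP s s0) n.
  by rewrite mulfK// weight_norm_neq0.
apply: derivableM.
  have [] // := is_derive_moment_poly _ _ alpha0 beta0 _ _ _ t0
    (is_derive_polyM _ _ _ _ _ (is_derive_poly_cst 'X t)
      (is_derive_polyM _ _ _ _ _ du du)).
apply: derivableV; first exact: weight_norm_neq0.
by have [] := is_derive_ortho_norm _ _ _ t0 du.
Unshelve. all: by end_near. Qed.

(** Quotient rule for b_(n+1) = h_(n+1) / h_n, with the derivatives of the two norms. *)
Lemma is_derive_recurrence_beta n t u v : 0 < t ->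
  is_derive_poly (P n) t u -> is_derive_poly (P n.+1) t v ->
  let K p := moment (fun x => weight alpha beta t x / x) p in
  is_derive t 1 (b n.+1)
    ((K (P n t * P n t) / h n t - K (P n.+1 t * P n.+1 t) / h n.+1 t)
     * b n.+1 t).
Proof.
move=> t0 du dv K; have hn0 := weight_norm_neq0 _ _ t0.
have bE s : 0 < s -> b n.+1 s = h n.+1 s / h n s.
  move=> s0.
  have <- := recurrence_coef_beta _ _ _ (iw s s0) (orthP s s0) _ _
    (recP s s0) n.
  by rewrite mulfK// weight_norm_neq0.
apply: (near_eq_is_derive (f := h n.+1 * (fun s => (h n s)^-1))).
  near=> s; rewrite bE//; near: s; exact: lt_nbhsr.
have := is_deriveM (is_derive_ortho_norm _ _ _ t0 dv)
  (is_deriveV (hn0 n) (is_derive_ortho_norm _ _ _ t0 du)).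
move/is_derive_eq; apply; rewrite bE// /GRing.scale/= -!/(K _).
by field; rewrite !hn0.
Unshelve. all: by end_near. Qed.

(** P_(n+2) = (X - a_(n+1)) P_(n+1) - b_(n+1) P_n involves two predecessors, so the induction
    carries a consecutive pair. *)
Lemma is_derive_ortho t n : 0 < t -> exists u, is_derive_poly (P n) t u.
Proof.
move=> t0; suff : (exists u, is_derive_poly (P n) t u) /\
    (exists u, is_derive_poly (P n.+1) t u) by case.
elim: n => [|n [[u du] [v dv]]].
  have [u du] : exists u, is_derive_poly (P 0%N) t u.
    exists 0; apply: is_derive_poly_near (is_derive_poly_cst 1 t).
    near=> s; have s0 : 0 < s by near: s; exact: lt_nbhsr.
    by case: (recP s s0).
  split; first by exists u.
  have /derivableP da := derivable_recurrence_alpha _ _ _ t0 du.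
  (* The witness is the one produced by the difference and product rules on X P_0 - a_0 P_0. *)
  eexists; apply: is_derive_poly_near; last first.
    exact: (is_derive_polyB _ _ _ _ _
      (is_derive_polyM _ _ _ _ _ (is_derive_poly_cst 'X t) du)
      (is_derive_polyM _ _ _ _ _ (is_derive_polyC _ _ _ da) du)).
  near=> s; have s0 : 0 < s by near: s; exact: lt_nbhsr.
  case: (recP s s0) => _ /(_ 0%N) ->.
  by rewrite addr0 mul_polyC addrK.
split; first by exists v.
have /derivableP da := derivable_recurrence_alpha _ _ _ t0 dv.
have db := is_derive_recurrence_beta _ _ _ _ t0 du dv.
eexists; apply: is_derive_poly_near; last first.
  exact: (is_derive_polyB _ _ _ _ _ (is_derive_polyB _ _ _ _ _
      (is_derive_polyM _ _ _ _ _ (is_derive_poly_cst 'X t) dv)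
      (is_derive_polyM _ _ _ _ _ (is_derive_polyC _ _ _ da) dv))
    (is_derive_polyM _ _ _ _ _ (is_derive_polyC _ _ _ db) du)).
near=> s; have s0 : 0 < s by near: s; exact: lt_nbhsr.
case: (recP s s0) => _ /(_ n.+1) ->.
by rewrite -!mul_polyC; ring.
Unshelve. all: by end_near. Qed.

(** Differentiate L_t(P_n P_(n+1)) = 0: the term with dP_n/dt vanishes by degree, the term with v
    has degree at most n in v and gives v_n h_n, and the weight contributes - K_t(P_n P_(n+1)). *)
Lemma is_derive_subleading n t v : 0 < t -> is_derive_poly (P n.+1) t v ->
  v`_n * h n t =
    moment (fun x => weight alpha beta t x / x) (P n t * P n.+1 t).
Proof.
move=> t0 dv; have [u du] := is_derive_ortho t n t0.
have := is_derive_moment_poly _ _ alpha0 beta0 _ _ _ t0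
  (is_derive_polyM _ _ _ _ _ du dv).
set l := (X in is_derive _ _ _ X) => dl.
have d0 : is_derive t 1
    (fun s => moment (weight alpha beta s) (P n s * P n.+1 s)) 0.
  apply: near_eq_is_derive (is_derive_cst 0 t 1).
  near=> s; have s0 : 0 < s by near: s; exact: lt_nbhsr.
  by rewrite (moment_ortho _ _ _ (orthP s s0)) ltn_eqF// mulr0.
have : l = 0.
  by rewrite -(@derive_val _ _ _ _ _ _ _ dl) (@derive_val _ _ _ _ _ _ _ d0).
rewrite /l momentD; last exact: iw.
have un := size_is_derive_ortho _ _ _ t0 du.
rewrite (moment_ortho_lt _ _ _ (iw t t0) (orthP t t0) n.+1 n.+1 u)//;
  last exact: leqW.
rewrite add0r (mulrC (P n t) v).
rewrite (moment_ortho_coef _ _ _ (iw t t0) (orthP t t0) n).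
  by move/eqP; rewrite subr_eq0 => /eqP.
exact: size_is_derive_ortho dv.
Unshelve. all: by end_near. Qed.

(** Multiplying the preceding identity by t / h_n turns K_t(P_n P_(n+1)) into r*_(n+1). *)
Lemma is_derive_subleading_rstar n t v : 0 < t -> is_derive_poly (P n.+1) t v ->
  t * v`_n = rstar (weight alpha beta t) (P^~ t) (h^~ t) t n.+1.
Proof.
move=> t0 dv; rewrite /rstar.
under eq_Rintegral do rewrite -mulrA -hornerM.
rewrite -[X in t / h n t * X]/(moment (fun x => weight alpha beta t x / x) _).
rewrite -(is_derive_subleading _ _ _ t0 dv).
by field; exact: weight_norm_neq0.
Qed.

Lemma Rstar_moment n t : Rstar (weight alpha beta t) (P^~ t) (h^~ t) t n =
  t * (moment (fun x => weight alpha beta t x / x) (P n t * P n t) / h n t).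
Proof.
rewrite /Rstar; under eq_Rintegral do rewrite -mulrA expr2 -hornerM.
rewrite -[X in t / h n t * X]/(moment (fun x => weight alpha beta t x / x) _).
by rewrite -mulrA (mulrC _^-1).
Qed.

End evolution.

Theorem lemma4p3 (R : realType) (alpha beta : R)
  (halpha : 0 < alpha) (hbeta : 0 < beta)
  (P : nat -> R -> {poly R}) (h a b : nat -> R -> R)
  (hP : forall t : R, 0 < t ->
     monic_orthogonal (weight alpha beta t) (P^~ t) (h^~ t))
  (hab : forall t : R, 0 < t -> recurrence_coefs (P^~ t) (a^~ t) (b^~ t)) :
  let Rs n t := Rstar (weight alpha beta t) (P^~ t) (h^~ t) t n in
  let rs n t := rstar (weight alpha beta t) (P^~ t) (h^~ t) t n in
  forall t : R, 0 < t ->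
    (forall n : nat,
       derivable (a n) t 1 /\
       t * derive1 (a n) t = rs n t - rs n.+1 t) /\
    (forall n : nat, (1 <= n)%N ->
       derivable (b n) t 1 /\
       t * derive1 (b n) t = (Rs n.-1 t - Rs n t) * b n t).
Proof.
move=> Rs rs t t0.
have dP n : exists u, is_derive_poly (P n) t u.
  exact: (is_derive_ortho _ _ halpha hbeta _ _ _ _ hP hab).
split=> [n|[//|n] _].
  have [v dv] := dP n.+1.
  (* [u] is the derivative of the subleading coefficient of P_n; for n = 0 it is 0, in accordance
     with r*_0 = 0. *)
  have [u [tu du]] : exists u, t * u = rs n t /\ is_derive t 1
      (fun s => if n is k.+1 then (P n s)`_k else 0) u.
    case: n {v dv} => [|k].
      by exists 0; rewrite mulr0; split=> //; exact: is_derive_cst.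
    have [u du] := dP k.+1; exists u`_k; split; last by case: du.
    exact: (is_derive_subleading_rstar _ _ halpha hbeta _ _ _ _ hP hab).
  (* a_n is the difference of the subleading coefficients of P_n and P_(n+1), for all s near t. *)
  have da : is_derive t 1 (a n) (u - v`_n).
    apply: near_eq_is_derive (is_deriveB du (dv.2 n)).
    near=> s; have s0 : 0 < s by near: s; exact: lt_nbhsr.
    by rewrite (recurrence_coef_subleading _ _ _ (hP s s0) _ _ (hab s s0)).
  split; first by case: da.
  rewrite derive1E derive_val mulrBr tu; congr (_ - _).
  exact: (is_derive_subleading_rstar _ _ halpha hbeta _ _ _ _ hP hab).
have [[u du] [v dv]] := (dP n, dP n.+1).
have db := is_derive_recurrence_beta _ _ halpha hbeta _ _ _ _ hP hab
  _ _ _ _ t0 du dv.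
split; first by case: db.
(* The factor t distributes over the quotients K_t(P_k^2) / h_k for k = n and k = n+1, turning them
   into R*_n and R*_(n+1). *)
by rewrite derive1E derive_val /Rs !Rstar_moment/= -mulrBr mulrA.
Unshelve. all: by end_near. Qed.
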